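(* Let $\mathcal{A}$ be a unital $C^*$-algebra and $\mathcal{H}$ a complex Hilbert space with $\dim(\mathcal{H})<\infty$. Then every $C^*$-extreme point of $\mathrm{CCP}(\mathcal{A},\mathscr{B}(\mathcal{H}))$ is a linear extreme point of the convex set $\mathrm{CCP}(\mathcal{A},\mathscr{B}(\mathcal{H}))$.
   Context: $\mathscr{B}(\mathcal{H})$ is the algebra of bounded linear operators on $\mathcal{H}$, $I$ the identity operator. For $T\in\mathscr{B}(\mathcal{H})$, $\mathrm{Ad}_T(X):=T^*XT$. $\mathrm{CCP}(\mathcal{A},\mathscr{B}(\mathcal{H}))$ is the set of all contractive completely positive maps $\Phi:\mathcal{A}\to\mathscr{B}(\mathcal{H})$ (equivalently completely positive maps with $\Phi(1)\leq I$). A map $\Phi\in\mathrm{CCP}(\mathcal{A},\mathscr{B}(\mathcal{H}))$ is a $C^*$-extreme point of it if whenever $\Phi=\sum_{j=1}^n\mathrm{Ad}_{T_j}\circ\Phi_j$ with $\Phi_j\in\mathrm{CCP}(\mathcal{A},\mathscr{B}(\mathcal{H}))$ and $T_j\in\mathscr{B}(\mathcal{H})$ invertible with $\sum_{j=1}^nT_j^*T_j=I$, there exist unitaries $U_j\in\mathscr{B}(\mathcal{H})$ with $\Phi_j=\mathrm{Ad}_{U_j}\circ\Phi$ for all $j$. Linear extreme points are extreme points in the usual convexity sense. *)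

(* Defs.v *)
From HB Require Import structures.
From mathcomp Require Import all_boot all_order all_algebra complex.
From mathcomp Require Import sesquilinear.
From mathcomp Require Import boolp classical_sets functions reals.

Set Implicit Arguments.
Unset Strict Implicit.
Unset Printing Implicit Defensive.

Import Order.TTheory GRing.Theory Num.Theory.

Local Open Scope classical_set_scope.
Local Open Scope ring_scope.
Local Open Scope complex_scope.

(* The norm is a field of the structure and not the one of normedModType:
   Hierarchy Builder cannot join an algebra with a normed module below
   numDomainType. *)
HB.mixin Record isCStarAlgebra (R : realType) A of GRing.Algebra R[i] A := {
  star : A -> A;
  cnorm : A -> R;
  starK : involutive star;
  star_semilinear : forall (c : R[i]) (x y : A),
    star (c *: x + y) = Num.conj c *: star x + star y;
  starM : forall x y : A, star (x * y) = star y * star x;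
  cnorm0_eq0 : forall x : A, cnorm x = 0 -> x = 0;
  cnormD : forall x y : A, cnorm (x + y) <= cnorm x + cnorm y;
  cnormZ : forall (c : R[i]) (x : A), (cnorm (c *: x))%:C = `|c| * (cnorm x)%:C;
  cnormM : forall x y : A, cnorm (x * y) <= cnorm x * cnorm y;
  cstar_identity : forall x : A, cnorm (star x * x) = cnorm x ^+ 2;
  cnorm_complete : forall u : nat -> A,
    (forall e : R, 0 < e -> exists N : nat, forall m n : nat,
       (N <= m)%N -> (N <= n)%N -> cnorm (u m - u n) < e) ->
    exists l : A, forall e : R, 0 < e -> exists N : nat, forall n : nat,
       (N <= n)%N -> cnorm (u n - l) < e
}.

#[short(type="cstarAlgType")]
HB.structure Definition CStarAlgebra (R : realType) :=
  { A of GRing.Algebra R[i] A & isCStarAlgebra R A }.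

Section Extreme.
Variables (K : numDomainType) (V : lmodType K).

(* For K = R[i], the condition 0 < t < 1 forces t to be real. *)
Definition linear_extreme_point (E : set V) (x : V) : Prop :=
  E x /\ forall (y z : V) (t : K), E y -> E z -> 0 < t < 1 ->
    x = t *: y + (1 - t) *: z -> y = x /\ z = x.

End Extreme.

(* A finite-dimensional complex Hilbert space is a vectType over R[i] with a
   positive definite hermitian form, linear in its first argument. Completeness
   is automatic, and every linear operator is bounded, so that B(H) is 'End(H). *)
Section Operators.
Variables (R : realType) (H : vectType R[i]).
Variable dot : {dot H for (@Num.Def.conjC R[i])}.
Implicit Types (S T U X : 'End(H)).

Definition hnorm (x : H) : R := Num.sqrt (complex.Re (dot x x)).

Definition is_adjoint T S : Prop := forall x y : H, dot (T x) y = dot x (S y).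

Definition adjoint T : 'End(H) := xget 0%R [set S | is_adjoint T S].

Definition op_invertible T : Prop :=
  exists S, (S \o T = \1)%VF /\ (T \o S = \1)%VF.

Definition unitary U : Prop :=
  (adjoint U \o U = \1)%VF /\ (U \o adjoint U = \1)%VF.

Definition Ad T X : 'End(H) := (adjoint T \o X \o T)%VF.

(* A matrix of operators is an operator on the direct sum H^m. *)
Definition positive_opmx m (T : 'M['End(H)]_m) : Prop :=
  forall h : 'I_m -> H, 0 <= \sum_i dot (\sum_j T i j (h j)) (h i).

End Operators.

Section AdjointTheory.
Variables (R : realType) (H : vectType R[i]).
Variable dot : {dot H for (@Num.Def.conjC R[i])}.
Implicit Types (S T : 'End(H)).

Let n := \dim {:H}.
Let b := vbasis {:H}.
Let G : 'M[R[i]]_n := \matrix_(i, j) dot b`_i b`_j.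

Let dotZl c x y : dot (c *: x) y = c * dot x y.
Proof. exact: linearZl_LR. Qed.

Let dotZr c x y : dot x (c *: y) = Num.conj c * dot x y.
Proof. exact: linearZr_LR. Qed.

Let dotDr x y z : dot x (y + z) = dot x y + dot x z.
Proof. exact: linearDr. Qed.

Let dotBr x y z : dot x (y - z) = dot x y - dot x z.
Proof. exact: linearBr. Qed.

Let dot_suml (E : 'I_n -> H) y : dot (\sum_i E i) y = \sum_i dot (E i) y.
Proof. exact: linear_sumlz. Qed.

Let dot_sumr (E : 'I_n -> H) x : dot x (\sum_i E i) = \sum_i dot x (E i).
Proof. exact: linear_sumr. Qed.

Let basis_sum (x : H) : x = \sum_(i < n) coord b i x *: b`_i.
Proof. exact: coord_vbasis (memvf x). Qed.

Let G_unit : G \in unitmx.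
Proof.
rewrite -row_free_unit -kermx_eq0; apply/eqP/row_matrixP => k.
set v := row k _; rewrite row0.
have vG : v *m G = 0 by rewrite /v -row_mul mulmx_ker row0. clearbody v.
pose u := \sum_(i < n) v 0 i *: b`_i.
have ub (j : 'I_n) : dot u b`_j = 0.
  have := congr1 (fun M : 'rV[R[i]]_n => M 0 j) vG; rewrite !mxE => <-.
  rewrite /u dot_suml; apply: eq_bigr => i _.
  by rewrite dotZl mxE.
have u0 : u = 0.
  apply/eqP; rewrite -(dnorm_eq0 dot) {2}(basis_sum u) dot_sumr big1 // => j _.
  by rewrite dotZr ub mulr0.
have /freeP fb : free b by exact: basis_free (vbasisP _).
by apply/rowP => j; rewrite (fb _ u0) mxE.
Qed.

Let adj_fun T (y : H) : H :=
  \sum_(j < n) Num.conj ((invmx G *m \col_i dot (T b`_i) y) j 0) *: b`_j.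

Let adj_fun_linear T : linear (adj_fun T).
Proof.
move=> c x y; rewrite /adj_fun scaler_sumr -big_split /=.
apply: eq_bigr => j _; rewrite scalerA -scalerDl; congr (_ *: _).
rewrite !mxE -[c in RHS](@conjCK R[i]) -rmorphM -rmorphD /=; congr Num.conj.
rewrite mulr_sumr -big_split /=; apply: eq_bigr => i _.
by rewrite !mxE dotDr dotZr mulrDr mulrCA.
Qed.

Lemma adjoint_exists T : exists S, is_adjoint dot T S.
Proof.
pose L := GRing.isLinear.Build _ _ _ _ (adj_fun T) (adj_fun_linear T).
pose F : {linear H -> H} := HB.pack (adj_fun T) L.
exists (linfun F) => x y; rewrite lfunE /= (basis_sum x).
rewrite linear_sum !dot_suml /=; apply: eq_bigr => i _.
rewrite linearZ /= !dotZl; congr (_ * _).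
set w := invmx G *m \col_i dot (T b`_i) y.
have Gw : G *m w = \col_i dot (T b`_i) y by rewrite mulKVmx.
have := congr1 (fun M : 'cV[R[i]]_n => M i 0) Gw; rewrite !mxE => <-.
rewrite /adj_fun dot_sumr; apply: eq_bigr => j _.
by rewrite dotZr mxE conjCK mulrC.
Qed.

Lemma adjointP T : is_adjoint dot T (adjoint dot T).
Proof.
have [S TS] := adjoint_exists T.
exact: (@xgetPex _ 0 [set S | is_adjoint dot T S]) (ex_intro _ S TS).
Qed.

Lemma adjoint_unique T S : is_adjoint dot T S -> S = adjoint dot T.
Proof.
move=> TS; apply/lfunP => y; apply/eqP; rewrite -subr_eq0 -(dnorm_eq0 dot).
by rewrite dotBr -TS -adjointP subrr.
Qed.

End AdjointTheory.

Section CCP.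
Variables (R : realType) (A : cstarAlgType R) (H : vectType R[i]).
Variable dot : {dot H for (@Num.Def.conjC R[i])}.
Implicit Type Phi : A -> 'End(H).

Definition star_mx m (X : 'M[A]_m) : 'M[A]_m := map_mx star X^T.

(* The positive elements of the C*-algebra M_m(A). *)
Definition positive_mx m (P : 'M[A]_m) : Prop :=
  exists X : 'M[A]_m, P = star_mx X *m X.

Definition completely_positive Phi : Prop :=
  forall m (P : 'M[A]_m), positive_mx P -> positive_opmx dot (map_mx Phi P).

(* The bound ||Phi a|| <= ||a|| on operator norms. *)
Definition contractive Phi : Prop :=
  forall (a : A) (x : H), hnorm dot (Phi a x) <= cnorm a * hnorm dot x.

Definition CCP : set (A -> 'End(H)) :=
  [set Phi | [/\ linear Phi, completely_positive Phi & contractive Phi]].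

Definition cstar_extreme_point Phi : Prop :=
  CCP Phi /\
  forall (n : nat) (T : 'I_n -> 'End(H)) (Psi : 'I_n -> A -> 'End(H)),
    (forall j, CCP (Psi j)) ->
    (forall j, op_invertible (T j)) ->
    \sum_j (adjoint dot (T j) \o T j)%VF = \1%VF ->
    (forall a, Phi a = \sum_j Ad dot (T j) (Psi j a)) ->
    forall j, exists U,
      unitary dot U /\ forall a, Psi j a = Ad dot U (Phi a).

End CCP.

(* Main.v *)
(** If [Phi = t Y + (1 - t) Z], take the scalars [sqrt t] and [sqrt (1 - t)] as
    C*-coefficients: C*-extremality makes [Y] and [Z] unitarily equivalent to
    [Phi]. Hence for each [a] the operators [Phi a], [Y a] and [Z a] have the
    same Hilbert-Schmidt norm, and strict convexity of that norm forces them
    to coincide. *)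
Require Import Defs.
From mathcomp Require Import all_boot all_order all_algebra complex ring.
From mathcomp Require Import sesquilinear.
From mathcomp Require Import boolp classical_sets functions reals.

Import Order.TTheory GRing.Theory Num.Theory.

Local Open Scope ring_scope.

Section OrthonormalBasis.
Set Implicit Arguments.
Unset Strict Implicit.
Variables (C : numClosedFieldType) (H : vectType C).
Variable dot : {dot H for (@Num.Def.conjC C)}.

(** Gram-Schmidt: an orthonormal family of fewer than [\dim {:H}] vectors misses some [v], and the
    component [Y] of [v] orthogonal to the family is nonzero, so it can be normalised and added. *)
Lemma orthonormal_basis_exists :
  exists2 e : seq H, orthonormal dot e & (<<e>> = fullv)%VS.
Proof.
suff ext k : (k <= \dim {:H})%N ->
    exists2 e : seq H, orthonormal dot e & size e = k.
  have [e eo se] := ext _ (leqnn _); exists e => //; apply: span_basis.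
  by rewrite basisEfree (orthonormal_free eo) subvf se leqnn.
elim: k => [_|k IH kH]; first by exists [::].
have [e eo se] := IH (ltnW kH).
have /subvPn[v _ ve] : ~~ (fullv <= <<e>>)%VS.
  apply: contraL kH => /dimvS le; rewrite -leqNgt -se.
  exact: leq_trans le (dim_span e).
have [X Xe [Y [vXY _ Ye]]] := orthogonal_split dot e v.
have Y0 : Y != 0 by apply: contraNneq ve => Y0; rewrite vXY Y0 addr0.
exists ((sqrtC (dot Y Y))^-1 *: Y :: e); last by rewrite /= se.
rewrite -cat1s orthonormal_cat eo; apply/andP; split; last first.
  apply/orthoPl => y ye.
  by rewrite linearZl_LR /= (orthoPl Ye _ ye) mulr0.
rewrite /orthonormal /= !andbT dnormZ normfV (ger0_norm (sqrt_dnorm_ge0 _ _)).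
by rewrite exprVn sqrtCK mulVf// dnorm_eq0.
Qed.

Lemma orthonormal_expansion (e : seq H) (x : H) :
  orthonormal dot e -> (<<e>> = fullv)%VS -> x = \sum_(y <- e) dot x y *: y.
Proof.
move=> eo ef; have [ue oe] := orthonormalP eo.
set s := \sum_(y <- e) _; apply/eqP; rewrite -subr_eq0 -(dnorm_eq0 dot).
(* A vector orthogonal to a spanning family is orthogonal to itself. *)
suff ds : orthogonal dot [:: x - s] e.
  by rewrite (span_orthogonal ds) ?memv_span1// ef memvf.
apply/orthoPl => y ye.
rewrite linearBl linear_sumlz (bigD1_seq y)//= big1_seq => [|z /andP[zy ze]].
  by rewrite linearZl_LR /= (oe y y)// eqxx mulr1 addr0 subrr.
by rewrite linearZl_LR /= (oe z y)// (negPf zy) mulr0.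
Qed.

(** Parseval's identity. *)
Lemma dnorm_orthonormal (e : seq H) (x : H) :
  orthonormal dot e -> (<<e>> = fullv)%VS ->
  dot x x = \sum_(y <- e) `|dot x y| ^+ 2.
Proof.
move=> eo ef; rewrite {2}(orthonormal_expansion x eo ef) linear_sumr.
by apply: eq_bigr => y _; rewrite linearZr_LR /= normCK mulrC.
Qed.

(** Strict convexity in quantitative form: for [0 < t < 1] the defect term vanishes only if
    [x = y]. *)
Lemma dnorm_convex (t : C) (x y : H) : t \is Num.real ->
  dot (t *: x + (1 - t) *: y) (t *: x + (1 - t) *: y) =
  t * dot x x + (1 - t) * dot y y - t * (1 - t) * dot (x - y) (x - y).
Proof.
move=> tR.
rewrite !linearBl !linearBr !linearDl !linearDr /=.
rewrite !linearZl_LR !linearZr_LR /= rmorphB rmorph1 /= (conj_Creal tR).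
ring.
Qed.

(** The squared Hilbert-Schmidt norm when [e] is an orthonormal basis. *)
Definition hs_dnorm (e : seq H) (T : 'End(H)) : C :=
  \sum_(x <- e) dot (T x) (T x).

Lemma hs_dnorm_eq0 (e : seq H) (T : 'End(H)) :
  (<<e>> = fullv)%VS -> hs_dnorm e T = 0 -> T = 0.
Proof.
move=> ef /eqP; rewrite psumr_eq0 => [/allP Te|x _]; last exact: dnorm_ge0.
apply/lfunP => x; rewrite zero_lfunE; apply/eqP.
rewrite -memv_ker; suff /subvP : (fullv <= lker T)%VS by apply; exact: memvf.
rewrite -ef; apply/span_subvP => y /Te /=.
by rewrite dnorm_eq0 memv_ker.
Qed.

Lemma hs_dnorm_convex (e : seq H) (t : C) (S T : 'End(H)) :
  t \is Num.real ->
  hs_dnorm e (t *: S + (1 - t) *: T) =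
  t * hs_dnorm e S + (1 - t) * hs_dnorm e T - t * (1 - t) * hs_dnorm e (S - T).
Proof.
move=> tR; rewrite /hs_dnorm !mulr_sumr -big_split -sumrB /=.
apply: eq_bigr => x _.
by rewrite !lfunE /= !lfunE /= -dnorm_convex // opp_lfunE.
Qed.

(** By Parseval both sides are double sums over [e], with equal terms [|dot (T x) y|^2] and
    [|dot (S y) x|^2]; only the order of summation differs. *)
Lemma hs_dnorm_adjoint (e : seq H) (S T : 'End(H)) :
  orthonormal dot e -> (<<e>> = fullv)%VS ->
  (forall x y, dot (T x) y = dot x (S y)) -> hs_dnorm e T = hs_dnorm e S.
Proof.
move=> eo ef TS; rewrite /hs_dnorm.
under eq_bigr do rewrite (dnorm_orthonormal _ eo ef).
rewrite exchange_big; apply: eq_bigr => y _ /=.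
rewrite (dnorm_orthonormal _ eo ef); apply: eq_bigr => x _.
by rewrite TS hermC mul1r norm_conjC.
Qed.

End OrthonormalBasis.

Section Adjoint.
Set Implicit Arguments.
Unset Strict Implicit.
Variables (R : realType) (H : vectType (complex R)).
Variable dot : {dot H for (@Num.Def.conjC (complex R))}.

Lemma adjointPr (T : 'End(H)) (x y : H) :
  dot (adjoint dot T x) y = dot x (T y).
Proof.
by rewrite hermC mul1r /= -adjointP [in RHS]hermC mul1r.
Qed.

Lemma adjoint_real_scalar (s : complex R) : s \is Num.real ->
  adjoint dot (s *: \1%VF) = s *: \1%VF.
Proof.
move=> sR; apply/esym/adjoint_unique => x y.
by rewrite !lfunE /= !lfunE /= linearZl_LR linearZr_LR /= (conj_Creal sR).
Qed.

(** This turns an ordinary convex combination into a C*-convex one, with square roots of the weights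
    as coefficients. *)
Lemma Ad_real_scalar (s : complex R) (X : 'End(H)) : s \is Num.real ->
  Ad dot (s *: \1%VF) X = s ^+ 2 *: X.
Proof.
move=> sR; rewrite /Ad adjoint_real_scalar//.
by rewrite -comp_lfunZr comp_lfun1r -!comp_lfunZl comp_lfun1l scalerA.
Qed.

Lemma hs_dnorm_Ad (e : seq H) (U X : 'End(H)) :
  orthonormal dot e -> (<<e>> = fullv)%VS -> unitary dot U ->
  hs_dnorm dot e (Ad dot U X) = hs_dnorm dot e X.
Proof.
move=> eo ef [_ UUs].
have dUs x y : dot (adjoint dot U x) (adjoint dot U y) = dot x y.
  by rewrite adjointPr -comp_lfunE UUs id_lfunE.
have hs_Us (Y : 'End(H)) :
    hs_dnorm dot e (adjoint dot U \o Y)%VF = hs_dnorm dot e Y.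
  by apply: eq_bigr => x _; rewrite comp_lfunE dUs.
(* The left factor [adjoint dot U] is an isometry and drops out. The right factor [U] becomes such a
   left factor on passing to the adjoint of [X \o U]. *)
rewrite /Ad -comp_lfunA hs_Us.
rewrite (hs_dnorm_adjoint (S := (adjoint dot U \o adjoint dot X)%VF) eo ef);
  last first.
  by move=> x y; rewrite !comp_lfunE !adjointP.
by rewrite hs_Us; apply/esym/hs_dnorm_adjoint => // x y; exact: adjointP.
Qed.

End Adjoint.

Theorem corollary4p21 (R : realType) (A : cstarAlgType R)
    (H : vectType (complex R)) (dot : {dot H for (@Num.Def.conjC (complex R))})
    (Phi : A -> 'End(H)) (hPhi : cstar_extreme_point dot Phi) :
  linear_extreme_point (@CCP R A H dot) Phi.
Proof.
have [PhiC ext] := hPhi; split=> // Y Z t YC ZC /andP[t0 t1] PhiE.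
have t1' : 0 < 1 - t by rewrite subr_gt0.
have tR : t \is Num.real by exact: gtr0_real.
pose c (j : 'I_2) := if j == ord0 then t else 1 - t.
have c_gt0 j : 0 < c j by rewrite /c; case: ifP.
have sqrt_real j : sqrtC (c j) \is Num.real.
  by rewrite ger0_real// sqrtC_ge0 ltW.
pose T j : 'End(H) := sqrtC (c j) *: \1%VF.
pose Psi (j : 'I_2) := if j == ord0 then Y else Z.
have AdT j X : Ad dot (T j) X = c j *: X by rewrite Ad_real_scalar// sqrtCK.
have : forall j, exists U,
    unitary dot U /\ forall a, Psi j a = Ad dot U (Phi a).
  apply: (ext 2 T Psi) => [j|j||a].
  - by rewrite /Psi; case: ifP.
  - have s0 : sqrtC (c j) != 0 by rewrite sqrtC_eq0 gt_eqF.
    exists ((sqrtC (c j))^-1 *: \1%VF); rewrite /T.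
    rewrite -!comp_lfunZl -!comp_lfunZr comp_lfun1l !scalerA.
    by rewrite mulfV// mulVf// scale1r.
  (* Each summand is [Ad dot (T j)] applied to the identity. *)
  - have -> : \sum_j (adjoint dot (T j) \o T j)%VF = \sum_j c j *: \1%VF.
      by apply: eq_bigr => j _; rewrite -AdT /Ad comp_lfun1r.
    by rewrite -scaler_suml !big_ord_recl big_ord0 /c /= addr0 addrC subrK scale1r.
  - by rewrite PhiE !big_ord_recl big_ord0 !AdT /c /Psi /= addr0.
move=> PsiU; have [e eo ef] := orthonormal_basis_exists dot.
have hs_Psi j a : hs_dnorm dot e (Psi j a) = hs_dnorm dot e (Phi a).
  by have [U [Uu ->]] := PsiU j; exact: hs_dnorm_Ad.
have YZ : Y = Z.
  apply/funext => a; apply/subr0_eq.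
  apply: (hs_dnorm_eq0 (dot := dot) ef).
  (* The nonzero factor [t * (1 - t)] is restored so that the goal becomes the vanishing of the
     defect term in [hs_dnorm_convex]. *)
  have : t * (1 - t) != 0 by rewrite mulf_neq0 ?gt_eqF.
  move=> /mulfI; apply; rewrite mulr0.
  have := hs_dnorm_convex dot e (Y a) (Z a) tR.
  have -> : t *: Y a + (1 - t) *: Z a = Phi a by rewrite PhiE.
  (* With [h] the common value at [Phi a], [Y a] and [Z a], the identity reads
     [h = t * h + (1 - t) * h] minus the defect, so the defect is zero. *)
  have := hs_Psi ord0 a; have := hs_Psi ord_max a; rewrite /Psi /= => -> ->.
  rewrite -mulrDl [t + _]addrC subrK mul1r => /eqP.
  by rewrite -subr_eq0 opprB addrC subrK => /eqP.
by move: PhiE; rewrite YZ -scalerDl addrC subrK scale1r => ->.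
Qed.
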